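(* Let $n\ge2$ and let $\Omega\subset\mathbb R^n$ be a bounded John domain with John constant $C_\Omega$. Then for any $x\in\partial\Omega$ the number of connected components of the fiber $\Phi_x$ is at most $N(n,C_\Omega)$, a constant depending only on $n$ and $C_\Omega$.
   Context: John domain. $\Omega$ is a John domain with John constant $C_\Omega\ge1$ if there is a point $x_0\in\Omega$ such that every $x\in\Omega$ can be joined to $x_0$ by a rectifiable curve $\gamma:[0,l]\to\Omega$ parametrized by arc length with $\gamma(0)=x$, $\gamma(l)=x_0$ and $t\le C_\Omega\,\mathrm{dist}(\gamma(t),\mathbb R^n\setminus\Omega)$ for all $t\in[0,l]$. Royden algebra and compactification. The Royden algebra $\mathcal A(\Omega)$ is the algebra of all bounded continuous functions $u:\Omega\to\mathbb R$ (pointwise operations) whose first order weak partial derivatives exist and belong to $L^n(\Omega)$, with norm $\|u\|_{\Omega}=\|u\|_{L^\infty(\Omega)}+\|\nabla u\|_{L^n(\Omega)}$. The Royden compactification $\Omega^*$ is the set of all non-zero bounded linear (multiplicative) homomorphisms $\chi:\mathcal A(\Omega)\to\mathbb R$, with the relative weak$^*$ topology; it is a compact Hausdorff space. Points $x\in\Omega$ are identified with $\hat x\in\Omega^*$, $\hat x(u)=u(x)$. Fibers. For $x\in\partial\Omega$ the fiber $\Phi_x$ over $x$ is the set of all $\chi\in\Omega^*$ corresponding to Royden nets converging to $x$, i.e. those $\chi$ for which there is a net $(x_i)$ in $\Omega$ with $x_i\to x$ in $\mathbb R^n$ and $u(x_i)\to\chi(u)$ for every $u\in\mathcal A(\Omega)$.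 *)

(* Defs.v *)
From HB Require Import structures.
From mathcomp Require Import all_boot all_order all_algebra.
From mathcomp Require Import all_classical all_reals all_analysis.

Set Implicit Arguments.
Unset Strict Implicit.
Unset Printing Implicit Defensive.

Import Order.TTheory GRing.Theory Num.Theory.
Import numFieldTopology.Exports numFieldNormedType.Exports.

Local Open Scope classical_set_scope.
Local Open Scope ring_scope.

Section lebesgue_cons.
Context {R : realType} (n : nat).
Variable m :
  {sigma_finite_measure set (n.-tuple (measurableTypeR R)) -> \bar R}.

Let T := measurableTypeR R.

Definition cons_pair (p : T * n.-tuple T) : n.+1.-tuple T :=
  [the n.+1.-tuple T of p.1 :: p.2].

Definition uncons_pair (t : n.+1.-tuple T) : T * n.-tuple T :=
  (tnth t ord0, [tuple of behead t]).

Lemma cons_pairK : cancel cons_pair uncons_pair.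
Proof. by case=> x t; congr pair; apply/val_inj. Qed.

Lemma uncons_pairK : cancel uncons_pair cons_pair.
Proof.
by move=> t; apply/val_inj => /=; case/tupleP: t => x t; rewrite tnth0.
Qed.

Lemma measurable_cons_pair : measurable_fun [set: T * n.-tuple T] cons_pair.
Proof. by apply: measurable_cons. Qed.

Lemma measurable_uncons_pair :
  measurable_fun [set: n.+1.-tuple T] uncons_pair.
Proof.
apply/measurable_fun_pairP; split; first exact: measurable_tnth.
exact: measurable_behead.
Qed.

(* The image of the product of the one-dimensional Lebesgue measure and [m]
   under the identification of R x R^n with R^(n+1). *)
Definition lebesgue_cons : set (n.+1.-tuple T) -> \bar R :=
  pushforward (@lebesgue_measure R \x m)%E cons_pair.

Let lebesgue_cons0 : lebesgue_cons set0 = 0%E.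
Proof. by rewrite /lebesgue_cons /pushforward preimage_set0 measure0. Qed.

Let lebesgue_cons_ge0 A : (0 <= lebesgue_cons A)%E.
Proof. by rewrite /lebesgue_cons /pushforward measure_ge0. Qed.

Let lebesgue_cons_sigma_additive : semi_sigma_additive lebesgue_cons.
Proof.
move=> F mF tF mUF; rewrite /lebesgue_cons /pushforward preimage_bigcup.
apply: measure_semi_sigma_additive.
- by move=> k; rewrite -[X in measurable X]setTI;
    exact: measurable_cons_pair.
- apply/trivIsetP => /= i j _ _ ij; rewrite -preimage_setI.
  by move/trivIsetP : tF => /(_ _ _ _ _ ij) ->//; rewrite preimage_set0.
- by rewrite -preimage_bigcup -[X in measurable X]setTI;
    exact: measurable_cons_pair.
Qed.

HB.instance Definition _ := isMeasure.Build _ _ _ lebesgue_cons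
  lebesgue_cons0 lebesgue_cons_ge0 lebesgue_cons_sigma_additive.

Let lebesgue_cons_sigma_finite : sigma_finite setT lebesgue_cons.
Proof.
have /sigma_finiteP[F [FT ndF Foo]] := sigma_finiteT (@lebesgue_measure R).
have /sigma_finiteP[G [GT ndG Goo]] := sigma_finiteT m.
exists (fun k => uncons_pair @^-1` (F k `*` G k)).
  rewrite -preimage_bigcup -[LHS](preimage_setT uncons_pair); congr (_ @^-1` _).
  rewrite -setXTT FT GT predeqE => -[x y]; split.
    move=> [/= [i _ Fx] [j _ Gy]]; exists (maxn i j) => //; split.
    - by move: x Fx; exact/subsetPset/ndF/leq_maxl.
    - by move: y Gy; exact/subsetPset/ndG/leq_maxr.
  by move=> [i _ []/= ? ?]; split; exists i.
move=> k; have [mF Fk] := Foo k; have [mG Gk] := Goo k; split.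
  by rewrite -[X in measurable X]setTI; apply: measurable_uncons_pair => //;
    exact: measurableX.
rewrite /lebesgue_cons /pushforward -comp_preimage.
rewrite (_ : uncons_pair \o cons_pair = id); last exact/funext/cons_pairK.
by rewrite preimage_id product_measure1E// lte_mul_pinfty// ge0_fin_numE.
Qed.

HB.instance Definition _ := Measure_isSigmaFinite.Build _ _ _ lebesgue_cons
  lebesgue_cons_sigma_finite.

End lebesgue_cons.

Section euclidean.
Context {R : realType}.

Fixpoint lebesgue_tuple (n : nat) :
    {sigma_finite_measure set (n.-tuple (measurableTypeR R)) -> \bar R} :=
  match n with
  | 0 => \d_([tuple] : 0.-tuple (measurableTypeR R))
  | k.+1 => lebesgue_cons (lebesgue_tuple k)
  end.

Lemma lebesgue_tuple_box n (A : 'I_n -> set (measurableTypeR R)) :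
  (forall i, measurable (A i)) ->
  lebesgue_tuple n [set t | forall i, A i (tnth t i)] =
  (\prod_(i < n) lebesgue_measure (A i))%E.
Proof.
elim: n A => [|n IH] A mA /=.
  by rewrite big_ord0 diracE mem_set//= => -[].
have mB : measurable [set t : n.-tuple (measurableTypeR R) |
    forall i, A (lift ord0 i) (tnth t i)].
  rewrite (_ : [set t | _] = \bigcap_(i in [set: 'I_n])
      ((@tnth n _ ^~ i) @^-1` A (lift ord0 i))); last first.
    by by apply/seteqP; split=> [t H i _|t H i]; [exact: H|exact: (H i)].
  apply: fin_bigcap_measurable => // i _.
  by rewrite -[X in measurable X]setTI; exact: measurable_tnth.
rewrite big_ord_recl -IH// /lebesgue_cons /pushforward.
rewrite -product_measure1E//; congr (_ _).
apply/seteqP; split=> -[x t] /=.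
  move=> H; split; first by have := H ord0; rewrite /cons_pair tnth0.
  by move=> i; have := H (lift ord0 i); rewrite /cons_pair tnthS.
move=> [Ax At] i; case: (unliftP ord0 i) => [j|] ->.
  by rewrite /cons_pair tnthS.
by rewrite /cons_pair tnth0.
Qed.

Context {n : nat}.
Implicit Types (Omega K : set 'rV[R]_n) (f g u : 'rV[R]_n -> R).

(* Measure theory takes place on n-tuples, which carry the product
   sigma-algebra, topology and calculus on 'rV[R]_n. *)
Definition vec (t : n.-tuple (measurableTypeR R)) : 'rV[R]_n :=
  \row_i tnth t i.

(* The norm `|x| of the library on 'rV[R]_n is the max norm. *)
Definition eucl_norm (x : 'rV[R]_n) : R :=
  Num.sqrt (\sum_(i < n) x ord0 i ^+ 2).

Definition eucl_dist (x : 'rV[R]_n) (A : set 'rV[R]_n) : R :=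
  inf [set eucl_norm (x - y) | y in A].

Definition curve_variation (a b : R) (c : R -> 'rV[R]_n) (s : seq R) : R :=
  let F := c \o nth b (a :: s) in
  \sum_(0 <= k < size s) eucl_norm (F k.+1 - F k).

Definition curve_length (a b : R) (c : R -> 'rV[R]_n) : \bar R :=
  ereal_sup [set (curve_variation a b c s)%:E | s in itv_partition a b].

Definition arclength_parametrized (l : R) (c : R -> 'rV[R]_n) : Prop :=
  [/\ 0 <= l, {within `[0, l], continuous c} &
      forall t, 0 <= t <= l -> curve_length 0 t c = t%:E].

Definition john_domain (C : R) Omega : Prop :=
  [/\ open Omega, connected Omega &
    exists2 x0, Omega x0 & forall x, Omega x ->
      exists l c, [/\ arclength_parametrized l c, c 0 = x, c l = x0 &
        forall t, 0 <= t <= l ->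
          Omega (c t) /\ t <= C * eucl_dist (c t) (~` Omega)]].

Definition partial (i : 'I_n) f : 'rV[R]_n -> R :=
  fun x => 'D_(delta_mx ord0 i) f x.

Fixpoint Ck (k : nat) f : Prop :=
  continuous f /\
  match k with
  | 0 => True
  | k'.+1 => forall i : 'I_n,
      (forall x, derivable f x (delta_mx ord0 i)) /\ Ck k' (partial i f)
  end.

Definition test_function Omega f : Prop :=
  let supp := closure [set x | f x != 0] in
  [/\ forall k, Ck k f, compact supp & supp `<=` Omega].

Definition locally_L1 Omega f : Prop :=
  forall K, compact K -> K `<=` Omega ->
    (lebesgue_tuple n).-integrable (vec @^-1` K) (EFin \o f \o vec).

Definition weak_partial Omega u (i : 'I_n) g : Prop :=
  locally_L1 Omega g /\
  forall phi, test_function Omega phi ->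
    (\int[lebesgue_tuple n]_(t in vec @^-1` Omega)
        (u (vec t) * partial i phi (vec t))%:E =
     - \int[lebesgue_tuple n]_(t in vec @^-1` Omega)
        (g (vec t) * phi (vec t))%:E)%E.

(* L^p(Omega) and its norm, through extension by zero outside Omega. *)
Definition LebesgueFun Omega (p : \bar R) f : Prop :=
  (f \_ Omega) \o vec \in Lfun (lebesgue_tuple n) p.

Definition LebesgueNorm Omega (p : \bar R) f : \bar R :=
  'N[lebesgue_tuple n]_p[EFin \o (f \_ Omega) \o vec].

Definition dimE : \bar R := n%:R%:E.

(* A function on Omega is represented by its extension by zero, so that
   distinct elements of this set are distinct functions on Omega. *)
Definition royden_algebra Omega : set ('rV[R]_n -> R) :=
  [set u | [/\ forall x, ~ Omega x -> u x = 0,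
      {within Omega, continuous u},
      exists M, forall x, Omega x -> `|u x| <= M &
      forall i, exists2 g, weak_partial Omega u i g & LebesgueFun Omega dimE g]].

(* Weak derivatives are unique up to null sets: the choice does not affect
   the norm of the gradient. *)
Definition weak_gradient Omega u : 'rV[R]_n -> 'rV[R]_n :=
  fun x => \row_i xget (cst 0)
    [set g | weak_partial Omega u i g /\ LebesgueFun Omega dimE g] x.

Definition royden_norm Omega u : \bar R :=
  (LebesgueNorm Omega +oo u +
   LebesgueNorm Omega dimE (eucl_norm \o weak_gradient Omega u))%E.

(* The operations of the algebra are pointwise; linearity and
   multiplicativity are stated for every u, v, w of the algebra with w equal to
   the combination, resp. the product (which always belong to it).  The ambient {ptws _ -> _} carries the topology of pointwise convergence, which
   restricts to the weak* topology. *)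
Definition royden_compactification Omega :
    set {ptws royden_algebra Omega -> R} :=
  [set chi | [/\
      forall (a b : R) (u v w : royden_algebra Omega),
        (forall x, \val w x = a * \val u x + b * \val v x) ->
        chi w = a * chi u + b * chi v,
      forall u v w : royden_algebra Omega,
        (forall x, \val w x = \val u x * \val v x) -> chi w = chi u * chi v,
      exists M : R, forall u : royden_algebra Omega,
        (`|chi u|%:E <= M%:E * royden_norm Omega (\val u))%E &
      exists u : royden_algebra Omega, chi u != 0]].
Arguments royden_compactification Omega _ : clear implicits.

Definition directed (I : Type) (le : I -> I -> Prop) : Prop :=
  [/\ inhabited I, forall i, le i i,
      forall i j k, le i j -> le j k -> le i k &
      forall i j, exists k, le i k /\ le j k].

Definition tails (I : Type) (le : I -> I -> Prop) : set_system I :=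
  [set P | exists i0, forall i, le i0 i -> P i].

Definition fiber Omega (x : 'rV[R]_n) : set {ptws royden_algebra Omega -> R} :=
  [set chi | royden_compactification Omega chi /\
    exists (I : Type) (le : I -> I -> Prop) (y : I -> 'rV[R]_n),
      [/\ directed le, forall i, Omega (y i), y @ tails le --> x &
        forall u : royden_algebra Omega,
          (\val u (y i)) @[i --> tails le] --> chi u]].

Definition components (T : topologicalType) (A : set T) : set (set T) :=
  [set connected_component A x | x in A].

End euclidean.

Arguments royden_compactification {R n} Omega _.
Arguments fiber {R n} Omega x _.

(* Main.v *)
Require Import Defs.
From mathcomp Require Import all_boot all_order all_algebra.
From mathcomp Require Import all_classical all_reals all_analysis.
From mathcomp Require Import measurable_realfun ess_sup_inf ring lra.
Import Order.TTheory GRing.Theory Num.Theory.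
Import numFieldTopology.Exports numFieldNormedType.Exports.
Local Open Scope classical_set_scope.
Local Open Scope ring_scope.

Set Implicit Arguments.
Unset Strict Implicit.
Unset Printing Implicit Defensive.

(* Let D(r) be the part of Omega at distance less than r from x.  For small r,
   a John curve from y in D(r), followed up to arc length r, stays in D(3r) and
   ends at the centre of a ball of radius r/C contained in Omega.  That ball
   contains a point of a grid of mesh comparable to r/(C n), so D(r) is covered
   by the components of D(3r) at the N(n, C) points of this grid.

   The fiber over x is the cluster set, as r tends to 0, of the images of the
   D(r) in the space of functionals.  Along an ultrafilter, each of the N(n, C)
   families of components has an ultralimit, which is connected because the
   images lie in a product of compact intervals, and the fiber is the union of
   these ultralimits.

   Such a cluster point is a nonzero bounded functional because |u(y)| is at
   most the essential supremum of u, and because the constant 1 is in the Royden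
   algebra, i.e. the partial derivatives of a test function integrate to 0. *)

(** * Ultralimits of connected sets *)

(** By regularity each point of [A] lies off the closure of some neighbourhood of [B]. Compactness
    of [A], in its near-covering form over the shrinking neighbourhoods of [B], makes one of them
    serve all points of [A]. *)
Lemma compact_closed_separation (T : topologicalType) (A B : set T) :
  regular_space T -> compact A -> closed B -> A `&` B = set0 ->
  exists U V, [/\ open U, open V, A `<=` U, B `<=` V & U `&` V = set0].
Proof.
move=> regT cA cB AB0; have [->|/set0P B0] := eqVneq B set0.
  exists setT, set0; split => //; rewrite ?setI0//; [exact: openT|exact: open0].
have PFB := set_nbhs_pfilter B0.
have PFp := powerset_filter_from_filter PFB.
have /compact_near_coveringP ncA := cA.
have := ncA _ (powerset_filter_from (set_nbhs B)) (fun W y => ~ closure W y) _.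
case.
  move=> y Ay; have nBy : ~ B y.
    by move=> By; have : (A `&` B) y by []; rewrite AB0.
  have /regular_openP/(_ B cB nBy)[U [V [oU oV Uy BV UV0]]] := regT y.
  exists (U, [set W | W `<=` V]); first split=> /=.
  - exact: open_nbhs_nbhs.
  - apply: (@small_set_sub _ (set_nbhs B) V).
    by apply/set_nbhsP; exists V; split.
  - move=> [z W]/= [Uz WV] /(_ U)[|w [Ww Uw]]; first exact: open_nbhs_nbhs.
    have : (U `&` V) w by exact: conj Uw (WV _ Ww).
    by rewrite UV0.
move=> M [MB _ [W MW]] MA.
have /set_nbhsP[G [oG BG GW]] := MB _ MW.
exists (~` closure G), G; split => //.
- exact/closed_openC/closed_closure.
- by move=> y Ay /(closureS GW); exact: (MA _ MW).
- by apply/seteqP; split=> // y [] /[swap] /subset_closure.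
Qed.

Section ultralimit.
Context {T : topologicalType} {J : Type}.
Variables (U : set_system J) (A : J -> set T).
Hypothesis ultraU : UltraFilter U.

(** The Kuratowski limit of the sets [A j] along [U]; for an ultrafilter the upper and the lower
    limit coincide. *)
Definition ultralimit : set T :=
  [set p | forall V, nbhs p V -> U [set j | A j `&` V !=set0]].

Lemma closed_ultralimit : closed ultralimit.
Proof.
move=> p clp V; rewrite nbhsE => -[W [oW Wp] WV].
have [q [/(_ W) UqW Wq]] := clp W (open_nbhs_nbhs (conj oW Wp)).
apply: filterS (UqW (open_nbhs_nbhs (conj oW Wq))) => j [z [Az Wz]].
by exists z; split=> //; exact: WV.
Qed.

(* Points of the sets [A j] that avoid two open sets separating the ultralimit
   would accumulate outside these open sets. *)
Lemma connected_ultralimit (K : set T) : regular_space T -> compact K ->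
  closed K -> (forall j, A j `<=` K) -> (forall j, connected (A j)) ->
  connected ultralimit.
Proof.
move=> regT cK clK AK cA; apply/connectedP => E [E0 LE [s1 s2]].
have LK : ultralimit `<=` K.
  rewrite (closure_id K).1// => p Lp V /Lp /filter_ex [j [z [/AK Kz Vz]]].
  by exists z.
have cL : compact ultralimit.
  exact: subclosed_compact closed_ultralimit cK LK.
have clE b : closed (E b).
  move=> p clp; have : ultralimit p.
    have -> : ultralimit = closure ultralimit.
      exact/closure_id/closed_ultralimit.
    by apply: closureS clp => q; rewrite LE; case: b => ?; [right|left].
  case: b clp => clp; rewrite LE => -[]// Ep.
  - by suff : (E false `&` closure (E true)) p by rewrite s2.
  - by suff : (closure (E false) `&` E true) p by rewrite s1.
have cE b : compact (E b).
  apply: (subclosed_compact (clE b) cL).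
  by rewrite LE => q; case: b => ?; [right|left].
have [G1 [G2 [oG1 oG2 EG1 EG2 G12]]] : exists G1 G2,
  [/\ open G1, open G2, E false `<=` G1, E true `<=` G2 & G1 `&` G2 = set0].
  apply: compact_closed_separation => //; rewrite -subset0 -s1.
  by apply: setSI; exact: subset_closure.
have meet b G : open G -> E b `<=` G -> U [set j | A j `&` G !=set0].
  move=> oG EG; have [p Ep] := E0 b.
  have : ultralimit p by rewrite LE; case: (b) Ep; [right|left].
  by apply; apply: open_nbhs_nbhs; split=> //; exact: EG.
(* A connected [A j] that meets both of the disjoint open sets [G1] and [G2] cannot lie in their
   union. *)
have U12 : U [set j | (A j `\` (G1 `|` G2)) !=set0].
  apply: filterS (filterI (meet _ _ oG1 EG1) (meet _ _ oG2 EG2)).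
  move=> j [[z1 [Az1 Oz1]] [z2 [Az2 Oz2]]].
  apply: contrapT => N.
  have AO : A j `<=` G1 `|` G2.
    by move=> z Az; apply: contrapT => nO; apply: N; exists z.
  have sO : separated G1 G2.
    split; apply/seteqP; split=> // z [].
    - move=> clz O2z; have [w] := clz _ (open_nbhs_nbhs (conj oG2 O2z)).
      by rewrite G12.
    - move=> O1z clz; have [w [w2 w1]] := clz _ (open_nbhs_nbhs (conj oG1 O1z)).
      by have : (G1 `&` G2) w by []; rewrite G12.
  have [/(_ _ Az2) z21|/(_ _ Az1) z12] := connected_subset sO AO (cA j).
  - by have : (G1 `&` G2) z2 by []; rewrite G12.
  - by have : (G1 `&` G2) z1 by []; rewrite G12.
have [p0 _] := E0 true.
pose a j := xget p0 (A j `\` (G1 `|` G2)).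
have Ua : U [set j | (A j `\` (G1 `|` G2)) (a j)].
  by apply: filterS U12 => j [z zA]; apply: (@xgetI _ p0 _ z).
have aK : (a @ U) K.
  by change (U [set j | K (a j)]); apply: filterS Ua => j [/AK].
have [p [Kp clp]] := cK (a @ U) _ aK.
have Lp : ultralimit p.
  move=> V Vp.
  have [//|UN] := in_ultra_setVsetC [set j | A j `&` V !=set0] ultraU.
  have UV : (a @ U) (~` V).
    change (U [set j | ~ V (a j)]).
    by apply: filterS2 Ua UN => j [Aa _] N Va; apply: N; exists (a j).
  by have [q []] := clp _ _ UV Vp.
have := Lp; rewrite LE => Ep.
have : (G1 `|` G2) p by case: Ep => [/EG1|/EG2]; [left|right].
move=> G12p.
have UG : (a @ U) (~` (G1 `|` G2)).
  by change (U [set j | (~` (G1 `|` G2)) (a j)]); apply: filterS Ua => j [].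
have pG : nbhs p (G1 `|` G2).
  by apply: open_nbhs_nbhs; split=> //; exact: openU.
by have [q []] := clp _ _ UG pG.
Qed.

End ultralimit.

Lemma card_components_cover (T : topologicalType) (I : finType) (L : set T)
    (A : I -> set T) :
  (forall i, connected (A i)) -> L = \bigcup_i A i ->
  (components L #<= `I_#|I|)%card.
Proof.
move=> cA LA.
(* [f k] is the union of the components that meet the [k]-th piece: a single component, because the
   piece is connected, or the empty set if the piece is empty. No point of the piece has to be
   chosen. *)
pose f k : set T :=
  if insub k is Some o then
    \bigcup_(q in A (enum_val (o : 'I_#|I|))) connected_component L q
  else set0.
apply: (card_le_trans _ (card_image_le f `I_#|I|)).
apply: subset_card_le => _ [p + <-]; rewrite {1}LA => -[i _ Aip].
exists (enum_rank i : nat); first exact: ltn_ord.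
rewrite /f valK enum_rankK; apply/seteqP; split.
  move=> z [q Aiq].
  suff -> : connected_component L q = connected_component L p by [].
  apply: same_connected_component.
  apply: (connected_component_max _ _ (cA i)) => //.
  by rewrite LA => r Ar; exists i.
by move=> z Lz; exists p.
Qed.

(* [L], squeezed between cluster sets, is the union of the ultralimits of the
   families [A i]. *)
Lemma card_components_cluster (T : topologicalType) (J : Type) (I : finType)
    (F : set_system J) (B : J -> set T) (A : I -> J -> set T) (K L : set T) :
  ProperFilter F -> regular_space T -> compact K -> closed K ->
  (forall i j, A i j `<=` K) -> (forall i j, connected (A i j)) ->
  (\forall j \near F, B j `<=` \bigcup_i A i j) ->
  (forall p, L p -> \forall j \near F, closure (B j) p) ->
  (forall p i, (forall V, nbhs p V -> forall P, F P ->
     exists j, P j /\ A i j `&` V !=set0) -> L p) ->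
  (components L #<= `I_#|I|)%card.
Proof.
move=> PF regT cK clK AK cA BA LB AL.
have [G [uG FG]] := ultraFilterLemma PF.
apply: (@card_components_cover _ _ _ (fun i => ultralimit G (A i))).
  by move=> i; exact: (@connected_ultralimit _ _ _ _ _ K).
apply/seteqP; split=> p; last first.
  move=> [i _ Lp]; apply: (AL p i) => V /Lp GV P /FG GP.
  by have [j [? ?]] := filter_ex (filterI GV GP); exists j.
move=> Lp; apply: contrapT => N.
(* If [p] is in no ultralimit, each family misses some neighbourhood of [p] for [G]-most [j]. As [I]
   is finite, one neighbourhood and one [j] serve all families, although the cover by the [A i j]
   and the closure of [B j] at [p] force a meeting. *)
have /choice[V Vp] : forall i, exists V,
    nbhs p V /\ G (~` [set j | A i j `&` V !=set0]).
  move=> i; apply: contrapT => NV; apply: N; exists i => // V Vp.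
  have [//|GN] := in_ultra_setVsetC [set j | A i j `&` V !=set0] uG.
  by exfalso; apply: NV; exists V.
have pV : nbhs p [set q | forall i, V i q].
  by apply: filter_forall => i; have [] := Vp i.
have GV : G [set j | forall i, ~ (A i j `&` V i !=set0)].
  by apply: filter_forall => i; have [] := Vp i.
have [j [[Vj Bj] clj]] :=
  filter_ex (filterI (filterI GV (FG _ BA)) (FG _ (LB _ Lp))).
have [q [/Bj[i _ Aiq] Vq]] := clj _ pV.
by apply: (Vj i); exists q.
Qed.

Lemma ptws_cvg (I : Type) (T : topologicalType) (F : set_system {ptws I -> T})
    (f : {ptws I -> T}) : Filter F ->
  (forall i, g i @[g --> F] --> f i) -> F --> f.
Proof.
move=> FF Ff; apply/cvg_sup => i W [V [[G oG <-] fG] VW].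
have nG : nbhs (f i) G by exact: open_nbhs_nbhs.
have FG : F (fun g => G (g i)) := Ff i G nG.
by apply: (@filterS _ F FF _ _ _ FG) => g /VW.
Qed.

(** * Grid points and John curves *)

Section row_norms.
Context {R : realType} {n : nat}.
Implicit Types v w : 'rV[R]_n.

Lemma ler_norm_row v (a : R) : 0 <= a ->
  (forall j, `|v ord0 j| <= a) -> `|v| <= a.
Proof.
move=> a0 va; rewrite [leLHS]/Num.Def.normr/= mx_normrE (bigmax_le _ a0)//=.
by move=> -[i j] _ /=; rewrite ord1.
Qed.

Lemma row_norm_ge v j : `|v ord0 j| <= `|v|.
Proof.
rewrite [leRHS]/Num.Def.normr/= mx_normrE.
by apply/bigmax_geP; right => /=; exists (ord0, j).
Qed.

Lemma norm_le_eucl_norm v : `|v| <= eucl_norm v.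
Proof.
apply: ler_norm_row => [|j]; first exact: sqrtr_ge0.
rewrite -sqrtr_sqr ler_wsqrtr// (bigD1 j)//= lerDl.
by apply: sumr_ge0 => i _; exact: sqr_ge0.
Qed.

Lemma eucl_norm_le v : eucl_norm v <= n%:R * `|v|.
Proof.
have nv0 : 0 <= n%:R * `|v| by rewrite mulr_ge0.
rewrite -(ger0_norm nv0) -sqrtr_sqr ler_wsqrtr// exprMn.
apply: (@le_trans _ _ (\sum_(i < n) `|v| ^+ 2)).
  apply: ler_sum => i _; rewrite -real_normK ?num_real//.
  by rewrite lerXn2r ?nnegrE// row_norm_ge.
rewrite sumr_const card_ord -[leLHS]mulr_natl ler_wpM2r ?sqr_ge0//.
rewrite -natrX ler_nat; case: (n) => // k.
by rewrite expnS expn1 leq_pmulr.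
Qed.

Lemma eucl_normZ (a : R) v : eucl_norm (a *: v) = `|a| * eucl_norm v.
Proof.
rewrite /eucl_norm -sqrtr_sqr -sqrtrM ?sqr_ge0// mulr_sumr.
by congr Num.sqrt; apply: eq_bigr => i _; rewrite mxE exprMn.
Qed.

Lemma eucl_norm_ge0 v : 0 <= eucl_norm v.
Proof. exact: sqrtr_ge0. Qed.

Lemma eucl_dist_le v (A : set 'rV[R]_n) w : A w ->
  eucl_dist v A <= eucl_norm (v - w).
Proof.
move=> Aw; apply: ge_inf; last by exists w.
by exists 0 => _ [u _ <-]; exact: eucl_norm_ge0.
Qed.

Lemma connected_segment v w :
  connected [set v + s *: (w - v) | s in `[0, 1 : R]].
Proof.
apply: connected_continuous_connected; first exact: segment_connected.
apply: continuous_subspaceT => s.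
by apply: cvgD; [exact: cvg_cst|apply: cvgZr_tmp; exact: cvg_id].
Qed.

(** The one-step partition of [[0, t]] has the chord as its variation. It is a partition only for
    [0 < t], so [t = 0] is treated apart. *)
Lemma arclength_dist (l t : R) (c : R -> 'rV[R]_n) :
  arclength_parametrized l c -> 0 <= t <= l -> eucl_norm (c t - c 0) <= t.
Proof.
move=> [l0 cc cl] tl; have [t0 _] := andP tl.
have [->|tn0] := eqVneq t 0.
  by rewrite subrr /eucl_norm big1 ?sqrtr0// => i _; rewrite mxE expr0n.
rewrite -lee_fin -[leRHS](cl t tl); apply: ereal_sup_ubound.
exists [:: t]; first by apply: itv_partition1; rewrite lt_neqAle eq_sym tn0.
by rewrite /curve_variation big_nat1.
Qed.

End row_norms.

Section john.
Context {R : realType} {n : nat}.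
Variables (C : R) (Omega : set 'rV[R]_n).
Hypothesis C1 : 1 <= C.

(** [S] is the initial arc of length [r] and [z] its end point; the John condition at parameter [r]
    leaves room around [z] for a Euclidean ball of radius [r / C]. *)
Lemma john_cone (l r : R) (c : R -> 'rV[R]_n) : 0 < r <= l ->
  arclength_parametrized l c ->
  (forall t, 0 <= t <= l ->
     Omega (c t) /\ t <= C * eucl_dist (c t) (~` Omega)) ->
  exists S z, [/\ connected S, S (c 0), S z,
    (forall w, S w -> Omega w /\ `|w - c 0| <= r) &
    forall w, eucl_norm (z - w) < r / C -> Omega w].
Proof.
move=> /andP[r0 rl] al cO; have C0 : 0 < C by exact: lt_le_trans C1.
exists (c @` `[0, r]), (c r); split.
- apply: connected_continuous_connected; first exact: segment_connected.
  have [_ cc _] := al; apply: continuous_subspaceW cc.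
  by apply: subset_itvl; rewrite bnd_simp.
- by exists 0 => //=; rewrite in_itv/= lexx ltW.
- by exists r => //=; rewrite in_itv/= lexx ltW.
- move=> w [t /=]; rewrite in_itv/= => /andP[t0 tr] <-.
  have tl : 0 <= t <= l by rewrite t0 (le_trans tr).
  split; first by have [] := cO t tl.
  apply: (le_trans (norm_le_eucl_norm _)); apply: (le_trans _ tr).
  exact: (arclength_dist al tl).
- move=> w; rewrite ltr_pdivlMr// => wr; apply: contrapT => nOw.
  have [|_] := cO r; first by rewrite rl ltW.
  rewrite leNgt => /negP; apply; apply: le_lt_trans wr.
  by rewrite mulrC ler_wpM2r ?(ltW C0)// eucl_dist_le.
Qed.

(* The mesh of the grid is [r / (2 * C * n)]: each Euclidean ball of radius
   [r / C] centred at max-distance at most [2 * r] from [x] meets it. *)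
Definition grid_half : nat := (Num.truncn (4 * C * n%:R)).+1.

(** Coordinates run from 0 to twice [grid_half]; [grid_point] subtracts [grid_half] to centre the
    grid at [x]. The type depends on neither [x] nor [r], so its cardinality can serve as the
    bound. *)
Definition grid_index := {ffun 'I_n -> 'I_(grid_half.*2.+1)}.

Definition grid_point (x : 'rV[R]_n) (r : R) (k : grid_index) : 'rV[R]_n :=
  \row_j (x ord0 j + r / (2 * C * n%:R) * ((k j)%:R - grid_half%:R)).

Lemma grid_approx (x z : 'rV[R]_n) (r : R) : (0 < n)%N -> 0 < r ->
  `|z - x| <= 2 * r ->
  exists k, `|z - grid_point x r k| <= r / (2 * C * n%:R).
Proof.
move=> n0 r0 zx; set h := r / _.
have C0 : 0 < C by exact: lt_le_trans C1.
have nR : 0 < n%:R :> R by rewrite ltr0n.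
have h0 : 0 < h by rewrite divr_gt0// !mulr_gt0.
(* The grid reaches beyond distance [2 * r], since [4 * C * n] steps of length [h] make exactly
   [2 * r]. *)
have Kh : 2 * r < grid_half%:R * h.
  have : 4 * C * n%:R < grid_half%:R.
    by apply: truncnS_gt.
  rewrite -(ltr_pM2r h0); apply: le_lt_trans.
  rewrite /h mulrA ler_pdivlMr ?mulr_gt0//; lra.
(* The position of [z] in units of the mesh, counted from the lowest corner of the grid; its integer
   part is the index sought. *)
pose a j := (z ord0 j - x ord0 j) / h + grid_half%:R.
have a0 j : 0 <= a j.
  rewrite -lerBlDr sub0r ler_pdivlMr// mulNr lerNl.
  have := row_norm_ge (z - x) j; rewrite !mxE ler_norml => /andP[zx1 _].
  rewrite opprB.
  lra.
have aK j : (Num.truncn (a j) < grid_half.*2.+1)%N.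
  rewrite ltnS -(@ler_nat R); apply: (@le_trans _ _ (a j)).
    by rewrite truncn_le.
  rewrite -addnn natrD lerD2r ler_pdivrMr//.
  have := row_norm_ge (z - x) j; rewrite !mxE ler_norml => /andP[_ zx1].
  lra.
exists [ffun j => Ordinal (aK j)]; apply: ler_norm_row; first exact: ltW.
move=> j; rewrite !mxE ffunE /= -/h.
have := truncn_itv (a0 j) => /andP[t1 t2].
have -> : z ord0 j - (x ord0 j + h * ((Num.truncn (a j))%:R - grid_half%:R)) =
    h * (a j - (Num.truncn (a j))%:R).
  by rewrite /a; field; rewrite gt_eqF.
rewrite normrM (gtr0_norm h0) ler_piMr ?(ltW h0)// ger0_norm ?subr_ge0//.
by rewrite -natr1 in t2; lra.
Qed.

Lemma john_grid_cover (x : 'rV[R]_n) : (0 < n)%N -> john_domain C Omega ->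
  ~ Omega x -> exists2 d : R, 0 < d & forall r, 0 < r < d ->
    Omega `&` [set y | `|y - x| < r] `<=`
    \bigcup_k connected_component (Omega `&` [set y | `|y - x| < 3 * r])
      (grid_point x r k).
Proof.
move=> n0 [oO cO [x0 Ox0 J]] nOx.
have C0 : 0 < C by exact: lt_le_trans C1.
have nR : 0 < n%:R :> R by rewrite ltr0n.
have xx0 : 0 < `|x0 - x|.
  by rewrite normr_gt0 subr_eq0; apply/eqP => xx; apply: nOx; rewrite -xx.
(* Below half the distance from [x] to the John centre, a curve from a point within [r] of [x] to
   the centre has length at least [r]. *)
exists (`|x0 - x| / 2); first by rewrite divr_gt0.
move=> r /andP[r0 rd] y [Oy /= yx].
have [l [c [al c0 cl cO']]] := J y Oy.
have [l0 _ _] := al.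
have rl : r <= l.
  have : eucl_norm (c l - c 0) <= l.
    by apply: (arclength_dist al); rewrite l0 lexx.
  move=> /(le_trans (norm_le_eucl_norm _)); rewrite c0 cl.
  have := ler_distD y x0 x; lra.
have r0l : 0 < r <= l by rewrite r0.
have [S [z [cS Sc Sz SO zO]]] := john_cone r0l al cO'.
have zx : `|z - x| < 2 * r.
  have [_] := SO z Sz; rewrite c0; have := ler_distD y z x; lra.
have [k kz] := grid_approx n0 r0 (ltW zx).
exists k => //; set g := grid_point x r k.
have zg : eucl_norm (g - z) <= r / (2 * C).
  apply: (le_trans (eucl_norm_le _)); rewrite distrC.
  apply: (@le_trans _ _ (n%:R * (r / (2 * C * n%:R)))).
    by rewrite ler_pM2l.
  rewrite le_eqVlt; apply/orP; left; apply/eqP; field; by rewrite !gt_eqF.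
have r2C : r / (2 * C) <= r / 2.
  by rewrite ler_pM2l// lef_pV2 ?posrE ?mulr_gt0// ler_peMr.
(* The segment from the end of the arc to the grid point. Its length is at most [r / (2 * C)], so it
   stays in the ball of radius [r / C], and at distance less than [2 * r + r / 2] from [x]. *)
pose T : set 'rV[R]_n := [set z + s *: (g - z) | s in `[0, 1 : R]].
have TO w : T w -> Omega w /\ `|w - x| < 3 * r.
  move=> [s /=]; rewrite in_itv/= => /andP[s0 s1] <-; split.
    apply: zO; rewrite opprD addrA subrr sub0r -scaleNr eucl_normZ normrN.
    rewrite ger0_norm//.
    apply: (@le_lt_trans _ _ (1 * (r / (2 * C)))).
      by apply: ler_pM => //; exact: eucl_norm_ge0.
    by rewrite mul1r ltr_pM2l// ltf_pV2 ?posrE ?mulr_gt0// ltr_pMl// ltr1n.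
  have : `|s *: (g - z)| <= r / 2.
    rewrite normrZ ger0_norm//; apply: (le_trans _ r2C).
    apply: (le_trans _ zg); apply: (le_trans _ (norm_le_eucl_norm _)).
    by rewrite ler_piMl.
  have := ler_normD (s *: (g - z)) (z - x).
  by rewrite addrCA addrA; lra.
have Tg : T g.
  by exists 1 => /=; rewrite ?in_itv/= ?ler01 ?lexx// scale1r subrKC.
have Tz : T z.
  by exists 0 => /=; rewrite ?in_itv/= ?ler01 ?lexx// scale0r addr0.
apply: (@connected_component_max _ _ (S `|` T)).
- by right.
- move=> w [Sw|/TO//]; have [Ow wy] := SO w Sw; split => //=.
  move: wy; rewrite c0; have := ler_distD y w x; lra.
- apply: connectedU => //; first by exists z.
  exact: connected_segment.
- by left; rewrite -c0.
Qed.

End john.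

(** * Lebesgue measure on tuples *)

Section tuple_measure.
Context {R : realType}.
Local Notation T := (measurableTypeR R).

Definition tuple_box n (c : 'I_n -> R) (e : R) : set (n.-tuple T) :=
  [set t | forall i, ball (c i) e (tnth t i)].

Lemma measurable_tuple_box n (c : 'I_n -> R) (e : R) :
  measurable (tuple_box c e).
Proof.
rewrite (_ : tuple_box c e = \bigcap_(i in [set: 'I_n])
    ((@tnth n T ^~ i) @^-1` ball (c i) e)); last first.
  by apply/seteqP; split=> [t H i _|t H i]; [exact: H|exact: (H i)].
apply: fin_bigcap_measurable => // i _.
rewrite -[X in measurable X]setTI; apply: measurable_tnth => //.
exact: measurable_ball.
Qed.

Lemma lebesgue_tuple_boxE n (c : 'I_n -> R) (e : R) : 0 <= e ->
  lebesgue_tuple n (tuple_box c e) = ((e *+ 2) ^+ n)%:E.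
Proof.
move=> e0; rewrite /tuple_box (@lebesgue_tuple_box R n (fun i => ball (c i) e)).
  2: by move=> i; exact: measurable_ball.
under eq_bigr do rewrite lebesgue_measure_ball//.
by rewrite prodEFin prodr_const card_ord.
Qed.

Lemma preimage_vec_ball n (c : 'rV[R]_n) (e : R) : 0 < e ->
  vec @^-1` ball c e = tuple_box (c ord0) e.
Proof.
move=> e0; apply/seteqP; split => t /=.
  by move=> [_ H] i; have := H ord0 i; rewrite mxE.
by move=> H; split=> // i j; rewrite mxE ord1; exact: H.
Qed.

Lemma rat_vec_approx n (v : 'rV[R]_n) (e : R) : 0 < e ->
  exists q : 'rV[rat]_n, ball (map_mx ratr q : 'rV[R]_n) e v.
Proof.
move=> e0.
have /choice[q vq] : forall j, exists q : rat, ball (ratr q : R) e (v ord0 j).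
  move=> j; have [|q] := @rat_in_itvoo R (v ord0 j - e) (v ord0 j + e).
    by lra.
  rewrite in_itv/= => /andP[q1 q2]; exists q.
  by rewrite /ball/= ltr_norml; lra.
exists (\row_j q j); split=> // i j; rewrite !mxE ord1; exact: vq.
Qed.

(** [O] is the union of the max-norm balls inside it with rational centre and radius the inverse of
    a positive integer. There are countably many, and each is a box, measurable for the product
    sigma-algebra. *)
Lemma open_measurable_vec n (O : set 'rV[R]_n) : open O ->
  measurable (vec @^-1` O).
Proof.
move=> oO.
pose F (p : 'rV[rat]_n * nat) : set (n.-tuple T) :=
  if `[< ball (map_mx ratr p.1 : 'rV[R]_n) p.2.+1%:R^-1 `<=` O >]
  then vec @^-1` ball (map_mx ratr p.1 : 'rV[R]_n) p.2.+1%:R^-1 else set0.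
suff -> : vec @^-1` O = \bigcup_p F p.
  apply: countable_bigcupT_measurable => // p; rewrite /F.
  case: ifPn => // _; rewrite preimage_vec_ball//.
  exact: measurable_tuple_box.
apply/seteqP; split => t /=; last first.
  by move=> [p _]; rewrite /F; case: ifPn => // /asboolP H /H.
move=> Ot; have /nbhs_ballP[e /= e0 eO] := open_nbhs_nbhs (conj oO Ot).
(* Half of [e], because a ball of this radius containing [vec t] extends up to twice the radius from
   [vec t]. *)
have [k ke] : exists k : nat, k.+1%:R^-1 < e / 2.
  have e20 : 0 < e / 2 by rewrite divr_gt0.
  have [N _ NP] := near_infty_natSinv_lt (PosNum e20).
  by exists N; exact: (NP N (leqnn N)).
have [|q qt] := @rat_vec_approx n (vec t) (k.+1%:R^-1); first by [].
exists (q, k) => //; rewrite /F /= ifT//; apply/asboolP => w qw; apply: eO.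
have := ball_triangle (ball_sym qt) qw; apply: le_ball.
by rewrite [e in _ <= e]splitr lerD// ltW.
Qed.

Lemma continuous_measurable_vec n (f : 'rV[R]_n -> R) : continuous f ->
  measurable_fun [set: n.-tuple T] (f \o vec).
Proof.
move=> cf; apply: (measurability _ (RGenOpens.measurableE R)).
move=> _ [_ [a [b ->] <-]].
rewrite setTI comp_preimage; apply: open_measurable_vec.
by apply: open_comp; [move=> y _; exact: cf|exact: interval_open].
Qed.

(** Otherwise, by continuity, |u| would exceed its essential supremum on a whole box around [y],
    which has positive measure. *)
Lemma normr_le_LebesgueNorm n (Omega : set 'rV[R]_n) u y : open Omega ->
  {within Omega, continuous u} -> Omega y ->
  (`|u y|%:E <= LebesgueNorm Omega +oo u)%E.
Proof.
move=> oO cu Oy; rewrite /LebesgueNorm unlock /Lnorm.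
set mu := lebesgue_tuple n.
have cuy : {for y, continuous u}.
  by move: cu; rewrite continuous_open_subspace// => /(_ y); apply; rewrite inE.
have box_gt0 e : 0 < e -> (0 < mu (tuple_box (y ord0) e))%E.
  move=> e0; rewrite lebesgue_tuple_boxE ?(ltW e0)// lte_fin exprn_gt0//.
  by rewrite mulrn_wgt0.
(* The norm with exponent [+oo] is the essential supremum only if the whole space has positive
   measure. *)
rewrite ifT; last first.
  apply: (lt_le_trans (box_gt0 _ ltr01)); apply: le_measure; rewrite ?inE//.
  exact: measurable_tuple_box.
rewrite leNgt; apply/negP; set S := ess_sup _ _ => Su.
have [e /= e0 eS] : exists2 e : R, 0 < e & forall w, ball y e w ->
    Omega w /\ (S < `|u w|%:E)%E.
  have nS : \forall w \near y, (S < `|u w|%:E)%E.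
    case: (S) Su => [s| |]//.
      rewrite lte_fin => su; near=> w; rewrite lte_fin; near: w.
      by apply: cvgr_gt su; apply: cvg_norm; exact: cuy.
    by move=> _; near=> w; rewrite ltNyr.
  have nO : nbhs y (Omega `&` [set w | (S < `|u w|%:E)%E]).
    exact: filterI (open_nbhs_nbhs (conj oO Oy)) nS.
  have /nbhs_ballP[e /= e0 eO] := nO.
  by exists e.
have [B [mB B0 NB]] := ess_sup_ge mu (abse \o ((EFin \o u \_ Omega) \o vec)).
have : (mu (tuple_box (y ord0) e) <= mu B)%E.
  apply: le_measure; rewrite ?inE//; first exact: measurable_tuple_box.
  move=> t; rewrite -preimage_vec_ball// => /eS [Ot St]; apply: NB => /=.
  by rewrite patchE mem_set//= leNgt St.
by rewrite B0 leNgt box_gt0.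
Unshelve. all: by end_near. Qed.

End tuple_measure.

(** * Vanishing integrals of derivatives, on the line and by slices *)

Section fundamental.
Context {R : realType}.

(** The fundamental theorem of calculus on [[-M, M]]; the last hypothesis includes |s| = M, so [g]
    vanishes at both end points. *)
Lemma integral_compact_derivative (g G : R -> R) (M : R) : 0 < M ->
  (forall s, derivable g s 1) -> (forall s, 'D_1 g s = G s) ->
  continuous G -> (forall s, M <= `|s| -> g s = 0 /\ G s = 0) ->
  (\int[lebesgue_measure]_s (G s)%:E = 0)%E.
Proof.
move=> M0 dg gG cG out.
have cg : continuous g.
  by move=> s; apply: differentiable_continuous; exact/derivable1_diffP.
have -> : (\int[lebesgue_measure]_s (G s)%:E =
    \int[lebesgue_measure]_(s in `[(- M)%R, M]) (G s)%:E)%E.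
  rewrite [RHS]integral_mkcond; apply: eq_integral => s _; rewrite patchE.
  case: ifPn => // /negP; rewrite inE/= in_itv/= -ler_norml => /negP.
  by rewrite -ltNge => /ltW /out [_ ->].
rewrite (@continuous_FTC2 _ G g).
- by rewrite (out M _).1 ?(out (- M) _).1 ?subee// ?normrN ger0_norm// ltW.
- by rewrite gt0_cp// opprK.
- exact: continuous_subspaceT.
- split; first by move=> s _; exact: dg.
  + exact/cvg_at_right_filter/cg.
  + exact/cvg_at_left_filter/cg.
- by move=> s _; rewrite derive1E.
Qed.

End fundamental.

Section slices.
Context {R : realType}.
Local Notation T := (measurableTypeR R).

Definition set_coord n (t : n.-tuple T) (i : 'I_n) (s : T) : n.-tuple T :=
  [tuple if k == i then s else tnth t k | k < n].

Lemma set_coord0 n (x s : T) (t : n.-tuple T) :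
  set_coord (cons_pair (x, t)) ord0 s = cons_pair (s, t).
Proof.
apply: eq_from_tnth => k; rewrite tnth_mktuple /cons_pair.
by case: (unliftP ord0 k) => [j|] ->; rewrite /= ?tnthS ?tnth0.
Qed.

Lemma set_coord_lift n (x s : T) (t : n.-tuple T) (i : 'I_n) :
  set_coord (cons_pair (x, t)) (lift ord0 i) s = cons_pair (x, set_coord t i s).
Proof.
apply: eq_from_tnth => k; rewrite tnth_mktuple /cons_pair.
case: (unliftP ord0 k) => [j|] ->; rewrite /= ?tnthS ?tnth0//.
by rewrite tnth_mktuple (inj_eq lift_inj).
Qed.

Lemma integrable_bounded_box n (G : n.-tuple T -> R) (M B : R) : 0 <= M ->
  measurable_fun setT G -> (forall t, `|G t| <= B) ->
  (forall t j, M <= `|tnth t j| -> G t = 0) ->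
  (lebesgue_tuple n).-integrable setT (EFin \o G).
Proof.
move=> M0 mG GB G0.
pose D : set (n.-tuple T) := tuple_box (fun=> 0) M.
have mD : measurable D by exact: measurable_tuple_box.
have -> : EFin \o G = (EFin \o G) \_ D.
  apply/funext => t; rewrite patchE; case: ifPn => // /negP; rewrite inE => nD.
  have [j nj] : exists j, ~ ball 0 M (tnth t j) by exact/existsNP.
  rewrite /= (G0 t j)//; rewrite leNgt; apply/negP => tM; apply: nj.
  by rewrite /ball/= sub0r normrN.
apply/(integrable_mkcond _ mD); apply: measurable_bounded_integrable => //.
- have : (lebesgue_tuple n D < +oo)%E by rewrite lebesgue_tuple_boxE ?ltry.
  by [].
- exact: measurable_funTS.
- exists B; split; first exact: num_real.
  by move=> x Bx t _; exact: le_trans (GB t) (ltW Bx).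
Qed.

(** Fubini, by induction on [n]. The first coordinate is integrated first if it is the coordinate
    [i]; otherwise it is integrated last, and the induction hypothesis makes the inner integrals
    vanish. *)
Lemma integral_slices0 n (i : 'I_n) (G : n.-tuple T -> R) (M B : R) :
  0 <= M -> measurable_fun setT G -> (forall t, `|G t| <= B) ->
  (forall t j, M <= `|tnth t j| -> G t = 0) ->
  (forall t, (\int[lebesgue_measure]_s (G (set_coord t i s))%:E = 0)%E) ->
  (\int[lebesgue_tuple n]_t (G t)%:E = 0)%E.
Proof.
move=> M0; elim: n => [|n IH] in i G *; first by case: i.
move=> mG GB G0 Gi.
have mc : measurable_fun setT (@cons_pair R n) := @measurable_cons_pair R n.
have mGc : measurable_fun setT (G \o @cons_pair R n) by exact: measurableT_comp.
have iG := integrable_bounded_box M0 mG GB G0.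
have iGc : (@lebesgue_measure R \x lebesgue_tuple n)%E.-integrable setT
    (EFin \o G \o @cons_pair R n).
  apply/integrableP; split; first exact/measurable_EFinP.
  move/integrableP : iG => [_]; apply: le_lt_trans.
  rewrite /= /lebesgue_cons ge0_integral_pushforward//.
  by apply: measurableT_comp => //; exact: measurableT_comp.
transitivity (\int[(@lebesgue_measure R \x lebesgue_tuple n)%E]_p
    (EFin \o G \o @cons_pair R n) p)%E.
  rewrite /= /lebesgue_cons integral_pushforward//.
  exact/measurable_EFinP.
case: (unliftP ord0 i) => [j|] ij; rewrite ij in Gi.
- rewrite -integral12_prod_meas1// integral0_eq// => x _.
  rewrite /fubini_F/=; apply: (IH j (fun t => G (cons_pair (x, t)))).
  + apply: measurableT_comp mGc _; exact: measurable_pair1.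
  + by move=> t; exact: GB.
  + move=> t k tk; apply: (G0 _ (lift ord0 k)).
    by rewrite /cons_pair tnthS.
  + move=> t; rewrite -[RHS](Gi (cons_pair (x, t))).
    by under [RHS]eq_integral do rewrite set_coord_lift.
- rewrite -integral21_prod_meas1// integral0_eq// => t _.
  (* The entry 0 is arbitrary, as [set_coord] overwrites it. *)
  rewrite /fubini_G/= -[RHS](Gi (cons_pair (0, t))).
  by under [RHS]eq_integral do rewrite set_coord0.
Qed.

End slices.

(** * Test functions, and the constant 1 in the Royden algebra *)

Section test_functions.
Context {R : realType} {n : nat}.
Local Notation T := (measurableTypeR R).
Implicit Types (Omega : set 'rV[R]_n) (phi : 'rV[R]_n -> R).

Lemma vec_set_coord (t : n.-tuple T) (i : 'I_n) (s : R) :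
  vec (set_coord t i s) = vec t + (s - tnth t i) *: delta_mx ord0 i.
Proof.
apply/rowP => k; rewrite !mxE tnth_mktuple eqxx/=.
by case: eqP => [->|]; rewrite ?mulr1 ?mulr0 ?addr0// subrKC.
Qed.

Lemma partial_eq0 phi (i : 'I_n) x : ~ closure [set x | phi x != 0] x ->
  partial i phi x = 0.
Proof.
move=> nx; rewrite /partial -(derive_cst (0 : R) (delta_mx ord0 i) x).
apply: near_eq_derive; near=> y => /=.
have : ~ closure [set x | phi x != 0] y.
  near: y; apply: open_nbhs_nbhs; split => //.
  exact/closed_openC/closed_closure.
by move=> ny; apply/eqP/negPn/negP => py; apply: ny; exact: subset_closure.
Unshelve. all: by end_near. Qed.

(** On each line parallel to the [i]-th axis, [partial i phi] is the derivative of a compactly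
    supported function of one variable. *)
Lemma integral_partial0 Omega phi (i : 'I_n) : test_function Omega phi ->
  (\int[lebesgue_tuple n]_t (partial i phi (vec t))%:E = 0)%E.
Proof.
move=> [Cphi cK _]; set K := closure _ in cK.
have [_ /(_ i)[dphi [cphi _]]] := Cphi 1%N.
(* Compactness gives a weak bound by any number above [N], such as |N| + 1; adding 1 more makes it
   strict. *)
have [M M0 KM] : exists2 M : R, 0 < M & forall x, K x -> `|x| < M.
  have [N [_ NK]] := compact_bounded cK; exists (`|N| + 2).
    by rewrite ltr_wpDl.
  move=> x Kx; apply: (@le_lt_trans _ _ (`|N| + 1)).
  2: by rewrite ltrD2l ltr1n.
  by apply: NK => //; rewrite (le_lt_trans (ler_norm N))// ltrDl.
have [B phiB] : exists B, forall x, `|partial i phi x| <= B.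
  have := continuous_compact (continuous_subspaceT (A := K) cphi) cK.
  move=> /compact_bounded[N [_ NK]]; exists (`|N| + 1) => x.
  have [Kx|/partial_eq0->] := pselect (K x); last by rewrite normr0 addr_ge0.
  by apply: NK; [rewrite (le_lt_trans (ler_norm N))// ltrDl|exists x].
have out (t : n.-tuple T) j : M <= `|tnth t j| -> ~ K (vec t).
  move=> tM /KM; rewrite ltNge => /negP; apply; apply: le_trans tM _.
  by have := row_norm_ge (vec t) j; rewrite mxE.
apply: (@integral_slices0 _ _ i _ M B).
- exact: ltW.
- exact: continuous_measurable_vec.
- by move=> t; exact: phiB.
- by move=> t j /out; exact: partial_eq0.
move=> t; pose g s := phi (vec (set_coord t i s)).
(* Since [vec (set_coord t i s)] moves with unit speed along the [i]-th basis vector, [g] and [phi]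
   have the same difference quotients. *)
have gE s : (fun h : R => h^-1 *: ((g \o shift s) (h *: 1) - g s)) =
    (fun h : R => h^-1 *: ((phi \o shift (vec (set_coord t i s)))
      (h *: delta_mx ord0 i) - phi (vec (set_coord t i s)))).
  apply/funext => h /=; congr (_ *: (phi _ - _)); rewrite !vec_set_coord.
  by rewrite -[h%:A]/(h * 1) mulr1 -addrA scalerDl addrCA.
apply: (@integral_compact_derivative _ g _ M) => //.
- by move=> s; rewrite /derivable gE; exact: dphi.
- by move=> s; rewrite /derive gE.
- move=> s; apply: continuous_comp; last exact: cphi.
  rewrite (_ : (fun s => vec (set_coord t i s)) =
    (fun s => vec t + (s - tnth t i) *: delta_mx ord0 i)); last first.
    by apply/funext => u; exact: vec_set_coord.
  apply: cvgD; first exact: cvg_cst.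
  by apply: cvgZr_tmp; apply: cvgB; [exact: cvg_id|exact: cvg_cst].
- move=> s sM; have nK : ~ K (vec (set_coord t i s)).
    by apply: (out _ i); rewrite tnth_mktuple eqxx.
  split; last exact: partial_eq0.
  by apply/eqP/negPn/negP => ps; apply: nK; exact: subset_closure.
Qed.

(** The weak gradient is 0: a test function has its support in [Omega], so integrating its partial
    derivative against 1 over [Omega] amounts to integrating it over the whole space. *)
Lemma royden_algebra_one Omega : open Omega -> (0 < n)%N ->
  royden_algebra Omega ((cst 1 : 'rV[R]_n -> R) \_ Omega).
Proof.
move=> oO n0.
have w0 i : weak_partial Omega ((cst 1 : 'rV[R]_n -> R) \_ Omega) i (cst 0).
  split.
    by move=> F _ _; exact: integrable0.
  move=> phi tphi; under [in RHS]eq_integral do rewrite mul0r.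
  rewrite integral0 oppe0 -[RHS](integral_partial0 i tphi) integral_mkcond.
  apply: eq_integral => t _; rewrite patchE; case: ifPn => [|/negP].
    by rewrite inE => /= Ot; rewrite patchE mem_set// mul1r.
  rewrite inE/= => nO; rewrite partial_eq0// => Kt; apply: nO.
  by case: tphi => _ _; apply.
split.
- by move=> x nO; rewrite patchE memNset.
- apply: (@subspace_eq_continuous _ Omega R (cst 1)).
    by move=> x Ox; rewrite /from_subspace patchE Ox.
  by move=> x; exact: cvg_cst.
- by exists 1 => x Ox; rewrite patchE mem_set// normr1.
- move=> i; exists (cst 0); first exact: w0.
  rewrite /LebesgueFun (_ : _ \o _ = cst 0); last first.
    by apply/funext => t /=; rewrite patchE; case: ifP.
  rewrite inE; apply/andP; split; rewrite inE/=; first exact: measurable_cst.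
  by rewrite /finite_norm Lnorm0// /dimE eqe pnatr_eq0 -lt0n.
Qed.

End test_functions.

(** * The fibers *)

Lemma tails_proper_filter (I : Type) (le : I -> I -> Prop) :
  directed le -> ProperFilter (tails le).
Proof.
move=> [[i0] lexx letr ledir]; apply: Build_ProperFilter_ex.
  by move=> P [i Pi]; exists i; exact: Pi.
split.
- by exists i0.
- move=> P Q [i Pi] [j Qj]; have [k [ik jk]] := ledir i j.
  by exists k => l kl; split; [apply: Pi|apply: Qj]; exact: letr kl.
- by move=> P Q PQ [i Pi]; exists i => j /Pi /PQ.
Qed.

Section fibers.
Context {R : realType} {n : nat}.
Variable Omega : set 'rV[R]_n.
Hypotheses (oO : open Omega) (n0 : (0 < n)%N).
Local Notation A := (royden_algebra Omega).

Definition evaluation (y : 'rV[R]_n) : {ptws A -> R} := fun u => \val u y.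

Lemma royden_algebra_memP (u : A) : royden_algebra Omega (\val u).
Proof. exact: set_mem (valP u). Qed.

Lemma continuous_evaluation (S : set 'rV[R]_n) : S `<=` Omega ->
  {within S, continuous evaluation}.
Proof.
move=> SO; apply: continuous_subspaceW SO _ => y.
apply: ptws_cvg => u; have [_ cu _ _] := royden_algebra_memP u.
exact: cu.
Qed.

(** Each [u] is bounded on [Omega], so evaluations lie in a product of segments: compact by
    Tychonoff, and closed because the product space is Hausdorff. *)
Lemma evaluation_compact : exists K : set {ptws A -> R},
  [/\ compact K, closed K & forall y, Omega y -> K (evaluation y)].
Proof.
have /choice[M Mu] : forall u : A, exists M,
    forall y, Omega y -> `|\val u y| <= M.
  by move=> u; have [_ _ [M HM] _] := royden_algebra_memP u; exists M.
pose K : set {ptws A -> R} :=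
  [set f | forall u : A, `[- M u, M u]%classic (f u)].
have cK : compact K.
  apply: (@tychonoff A (fun=> R) (fun u => `[- M u, M u]%classic)) => u.
  exact: segment_compact.
exists K; split => //; last first.
  by move=> y Oy u; rewrite /= in_itv/= -ler_norml; exact: Mu.
apply: compact_closed => //.
by apply: (@hausdorff_product A (fun=> R)) => _; exact: norm_hausdorff.
Qed.

(** Linearity, multiplicativity and the bound with constant 1 hold for evaluations at points of
    [Omega] and pass to the limit; the limit is nonzero because it sends the constant 1 to 1. *)
Lemma royden_compactification_limit (G : set_system 'rV[R]_n)
    (chi : {ptws A -> R}) : ProperFilter G -> G Omega ->
  (forall u : A, \val u y @[y --> G] --> chi u) ->
  royden_compactification Omega chi.
Proof.
move=> PG GO Gchi; split.
- move=> a b u v w wE; rewrite -(cvg_lim (@norm_hausdorff _ _) (Gchi w)).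
  apply/cvg_lim => //.
  have -> : (fun y => \val w y) = (fun y => a * \val u y + b * \val v y).
    exact/funext.
  by apply: cvgD; apply: cvgMl_tmp; exact: Gchi.
- move=> u v w wE; rewrite -(cvg_lim (@norm_hausdorff _ _) (Gchi w)).
  apply/cvg_lim => //.
  have -> : (fun y => \val w y) = (fun y => \val u y * \val v y).
    exact/funext.
  by apply: cvgM; exact: Gchi.
- exists 1 => u; rewrite mul1e.
  have [_ cu _ _] := royden_algebra_memP u.
  have uN y : Omega y -> (`|\val u y|%:E <= royden_norm Omega (\val u))%E.
    move=> Oy; apply: (le_trans (normr_le_LebesgueNorm oO cu Oy)).
    by rewrite /royden_norm leeDl// Lnorm_ge0.
  (* Any point of [Omega] excludes the value [-oo]. *)
  case: (royden_norm _ _) uN => [s uN|_|uN]; rewrite ?leey//; last first.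
    by have [y /uN] := filter_ex GO.
  rewrite lee_fin; apply: (cvgr_to_le (cvg_norm (Gchi u))).
  by apply: filterS GO => y /uN; rewrite lee_fin.
- pose one : A := SigSub (mem_set (royden_algebra_one oO n0)).
  exists one; suff -> : chi one = 1 by exact: oner_neq0.
  rewrite -(cvg_lim (@norm_hausdorff _ _) (Gchi one)); apply/cvg_lim => //.
  apply: cvg_near_cst; apply: filterS GO => y Oy.
  by rewrite /= patchE mem_set.
Qed.

(** This removes the nets: the fiber becomes the cluster set of the evaluations near [x]. For the
    converse, membership in the compactification comes from [royden_compactification_limit] along
    the net that is built. *)
Lemma fiberP (x : 'rV[R]_n) (chi : {ptws A -> R}) :
  fiber Omega x chi <-> forall r : R, 0 < r ->
    closure (evaluation @` (Omega `&` [set y | `|y - x| < r])) chi.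
Proof.
split=> [[_ [I [le [y [dir Oy yx ychi]]]]] r r0 V|clchi].
  have PF := tails_proper_filter dir.
  have : (evaluation \o y) @ tails le --> chi.
    by apply: ptws_cvg => u; exact: ychi.
  move=> /[apply] Vy; have yV : tails le [set i | V (evaluation (y i))] := Vy.
  have yr : tails le [set i | `|y i - x| < r].
    move/cvgrPdist_lt : yx => /(_ r r0); apply: filterS => i /=.
    by rewrite distrC.
  have [i [Vi ri]] := filter_ex (filterI yV yr).
  by exists (evaluation (y i)); split=> //; exists (y i).
(* The net is indexed by pairs of a neighbourhood of [chi] and a radius around [x]; later indices
   have smaller neighbourhoods and radii, so both convergences hold at once. *)
pose I := {p : set {ptws A -> R} * R | nbhs chi p.1 /\ 0 < p.2}.
pose le (p q : I) :=
  (projT1 q).1 `<=` (projT1 p).1 /\ (projT1 q).2 <= (projT1 p).2.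
have /choice[y yP] : forall p : I, exists y,
    [/\ Omega y, `|y - x| < (projT1 p).2 & (projT1 p).1 (evaluation y)].
  move=> [[V r] [/= nV r0]]; have [_ [[z [Oz zr] <-] Vz]] := clchi r r0 V nV.
  by exists z.
have dir : directed le.
  split.
  - by constructor; exists (setT, 1); split => //=; exact: filterT.
  - by move=> p; split.
  - by move=> p q s [pq1 pq2] [qs1 qs2]; split;
      [exact: subset_trans pq1|exact: le_trans pq2].
  - move=> [[V r] [nV r0]] [[W s] [nW s0]].
    have H : nbhs chi (V `&` W) /\ 0 < Num.min r s.
      by split; [exact: filterI|rewrite lt_min r0].
    exists (exist _ (V `&` W, Num.min r s) H).
    by split; split => /=; [exact: subIsetl|rewrite ge_min lexx
      |exact: subIsetr|rewrite ge_min lexx orbT].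
have PF := tails_proper_filter dir.
have yx : y @ tails le --> x.
  apply/cvgrPdist_lt => r r0.
  have H : nbhs chi setT /\ 0 < r by split => //; exact: filterT.
  exists (exist _ (setT, r) H) => q [_ /= qr].
  by rewrite distrC; have [_ + _] := yP q; move/lt_le_trans; apply.
have ychi (u : A) : \val u (y i) @[i --> tails le] --> chi u.
  move=> V Vu.
  have nV : nbhs chi [set f : {ptws A -> R} | V (f u)].
    exact: (@proj_continuous A (fun=> R) u chi).
  have H : nbhs chi [set f : {ptws A -> R} | V (f u)] /\ 0 < (1 : R) by [].
  exists (exist _ ([set f : {ptws A -> R} | V (f u)], 1) H) => q [/= qV _].
  by have [_ _ /qV] := yP q.
have Oy p : Omega (y p) by have [] := yP p.
split; last by exists I, le, y.
apply: (@royden_compactification_limit (y @ tails le)) => //.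
by have [[i0] _ _ _] := dir; exists i0 => p _; exact: Oy.
Qed.

End fibers.

Theorem corollary7 (R : realType) :
  exists N : nat -> R -> nat,
    forall (n : nat) (C : R) (Omega : set 'rV[R]_n),
      (2 <= n)%N -> 1 <= C -> bounded_set Omega -> john_domain C Omega ->
      forall x : 'rV[R]_n, (closure Omega `\` interior Omega) x ->
        (components (fiber Omega x) #<= `I_(N n C))%card.
Proof.
(* Explicitly, with k the integer part of 4Cn, this is the [n]-th power of 2k + 3. *)
exists (fun n C => #|{: @grid_index R n C}|).
move=> n C Omega n2 C1 _ jO x [_]; have [oO _ _] := jO.
rewrite (interior_id Omega).1// => nOx.
have n0 : (0 < n)%N by exact: leq_trans n2.
have [K [cK clK KO]] := evaluation_compact Omega.
have [d d0 cover] := john_grid_cover C1 n0 jO nOx.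
pose D r : set 'rV[R]_n := Omega `&` [set y | `|y - x| < r].
rewrite /=.
(* Empty when the grid point lies outside [D (3 * r)], so every index can be kept. *)
pose U (k : grid_index C) r :=
  connected_component (D (3 * r)) (grid_point x r k).
have UO k r : U k r `<=` Omega by move=> y /connected_component_sub[].
apply: (@card_components_cluster _ _ _ (0^'+)
  (fun r => @evaluation R n Omega @` D r)
  (fun k r => @evaluation R n Omega @` U k r) K) => //.
- exact: uniform_regular.
- by move=> k r _ [y /UO Oy <-]; exact: KO.
- move=> k r; apply: connected_continuous_connected.
    exact: component_connected.
  exact/continuous_evaluation/UO.
- near=> r => _ [y Dy <-].
  have [|k _ Uy] := cover r _ y Dy; last by exists k => //; exists y.
  by apply/andP; split.
- move=> p /(fiberP oO n0) clp; near=> r; exact: clp.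
- move=> p k H; apply/(fiberP oO n0) => r r0 V nV.
  (* The components at scale [j] lie in [D (3 * j)], which is inside [D r] once [j < r / 3]. *)
  have [|j [jr [_ [[y Uy <-] Vy]]]] := H V nV [set j | j < r / 3].
    by apply: nbhs_right_lt; rewrite divr_gt0.
  exists (evaluation y); split => //; exists y => //.
  have [Oy yj] := connected_component_sub Uy; split => //=.
  by move: yj jr => /=; lra.
Unshelve. all: by end_near. Qed.
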